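(* Let $\lambda$ be a nonzero real number. For integers $n\ge 0$ let $(x)_{0,\lambda}=1$ and $(x)_{n,\lambda}=x(x-\lambda)\cdots(x-(n-1)\lambda)$ for $n\ge1$. Define the degenerate Eulerian polynomials $A_{n,\lambda}(x)$ by $\sum_{j=0}^{\infty}(j+1)_{n,\lambda}x^{j}=\frac{A_{n,\lambda}(x)}{(1-x)^{n+1}}$ for $|x|<1$. Then $A_{0,\lambda}(x)=1$ and, for $n\ge1$, \[A_{n,\lambda}(x)=\sum_{i=0}^{n-1}\binom{n}{i}A_{i,\lambda}(x)\,(1)_{n-i,-\lambda}\,(x-1)^{n-i-1}.\]
   Context: $(1)_{m,-\lambda}=1(1+\lambda)(1+2\lambda)\cdots(1+(m-1)\lambda)$, i.e. the degenerate falling factorial with parameter $-\lambda$. *)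

(* Defs.v *)
From HB Require Import structures.
From mathcomp Require Import all_boot all_order all_algebra.
From mathcomp Require Import all_classical all_reals all_analysis.

Set Implicit Arguments.
Unset Strict Implicit.
Unset Printing Implicit Defensive.

Import Order.TTheory GRing.Theory Num.Theory.
Import numFieldNormedType.Exports.

Local Open Scope classical_set_scope.
Local Open Scope ring_scope.

(* (x)_{n,lam} = x (x - lam) ... (x - (n-1) lam), with (x)_{0,lam} = 1 *)
Definition deg_ffact (R : realType) (lam x : R) (n : nat) : R :=
  \prod_(i < n) (x - i%:R * lam).

Definition is_deg_eulerian (R : realType) (lam : R) (n : nat)
    (p : {poly R}) : Prop :=
  forall x : R, `|x| < 1 ->
    series (fun j => deg_ffact lam j.+1%:R n * x ^+ j) @ \oo
      --> p.[x] / (1 - x) ^+ n.+1.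

(* The polynomial satisfying is_deg_eulerian lam n; it is unique because its
   values on ]-1, 1[ are prescribed. xget would return the junk value 0 only
   if no such polynomial existed. *)
Definition deg_eulerian (R : realType) (lam : R) (n : nat) : {poly R} :=
  xget 0 [set p | is_deg_eulerian lam n p].

(* Main.v *)
(* Write S_n(x) = \sum_j (j+1)_{n,lam} x^j. For n >= 1, (0)_{n,lam} = 0 gives
   x S_n(x) = \sum_j (j)_{n,lam} x^j, and expanding j = (j+1) + (-1) by the
   degenerate Vandermonde convolution expresses it through S_0, ..., S_n.
   Isolating S_n gives the recurrence after multiplication by (1-x)^(n+1).
   Running the same computation on partial sums also yields the convergence of
   the series, hence the existence of A_n, by strong induction; A_n is unique
   because a polynomial is determined by its values on ]-1, 1[. *)
Require Import Defs.
From HB Require Import structures.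
From mathcomp Require Import all_boot all_order all_algebra.
From mathcomp Require Import all_classical all_reals all_analysis.
From mathcomp Require Import ring.

Set Implicit Arguments.
Unset Strict Implicit.
Unset Printing Implicit Defensive.

Import Order.TTheory GRing.Theory Num.Theory.
Import numFieldNormedType.Exports.

Local Open Scope classical_set_scope.
Local Open Scope ring_scope.

Lemma deg_ffact0 (R : realType) (lam x : R) : deg_ffact lam x 0 = 1.
Proof. by rewrite /deg_ffact big_ord0. Qed.

Lemma deg_ffactS (R : realType) (lam x : R) n :
  deg_ffact lam x n.+1 = deg_ffact lam x n * (x - n%:R * lam).
Proof. by rewrite /deg_ffact big_ord_recr. Qed.

Lemma deg_ffact_0l (R : realType) (lam : R) n : deg_ffact lam 0 n.+1 = 0.
Proof. by rewrite /deg_ffact big_ord_recl /= mul0r subr0 mul0r. Qed.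

Lemma deg_ffactN (R : realType) (lam x : R) n :
  deg_ffact lam (- x) n = (- 1) ^+ n * deg_ffact (- lam) x n.
Proof.
by elim: n => [|n IHn]; rewrite ?deg_ffact0 ?mulr1 // !deg_ffactS IHn exprS; ring.
Qed.

(** Induction on [n]: on the [i]-th term the new factor x + y - n lam splits as (x - i lam) + (y -
    (n-i) lam), each part extending one of the two factorials, and Pascal's rule recombines the two
    sums. *)
Lemma deg_ffactD (R : realType) (lam x y : R) n :
  deg_ffact lam (x + y) n =
  \sum_(i < n.+1) 'C(n, i)%:R * deg_ffact lam x i * deg_ffact lam y (n - i).
Proof.
elim: n => [|n IHn]; first by rewrite big_ord1 !deg_ffact0 bin0 !mulr1.
rewrite deg_ffactS IHn mulr_suml.
transitivity (\sum_(i < n.+1)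
   ('C(n, i)%:R * deg_ffact lam x i.+1 * deg_ffact lam y (n - i) +
    'C(n, i)%:R * deg_ffact lam x i * deg_ffact lam y (n.+1 - i))).
  apply: eq_bigr => i _; have lein : (i <= n)%N by rewrite -ltnS.
  by rewrite subSn // !deg_ffactS natrB //; ring.
rewrite big_split /= [RHS]big_ord_recl big_ord_recr /= [X in _ + X]big_ord_recl /=.
rewrite !bin0 !binn !subnn !subn0 !deg_ffact0 addrC -!addrA; congr (_ + _).
under [in RHS]eq_bigr do rewrite /bump /= add1n binS natrD 2!mulrDl subSS.
rewrite big_split big_ord_recr [in RHS]big_ord_recr /= bin_small // !mul0r addr0.
by rewrite binn subnn deg_ffact0.
Qed.

Lemma natr_expr_cvg0 (R : realType) (x : R) : `|x| < 1 ->
  (fun N => N%:R * x ^+ N) @ \oo --> (0 : R).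
Proof.
move=> x1; set w := Num.sqrt `|x|.
have w0 : 0 <= w by rewrite sqrtr_ge0.
have w1 : w < 1 by rewrite -sqrtr1 ltr_sqrt.
have ww : w ^+ 2 = `|x| by rewrite sqr_sqrtr.
(* Since w < 1, each w^i with i < N is at least w^N, so N w^N is at most a partial geometric sum.
   Then |N x^N| = (N w^N) w^N has a geometric bound. *)
have bound N : N%:R * w ^+ N <= (1 - w)^-1.
  have -> : N%:R * w ^+ N = \sum_(i < N) w ^+ N.
    by rewrite sumr_const card_ord mulr_natl.
  apply: (@le_trans _ _ (\sum_(i < N) w ^+ i)).
    by apply: ler_sum => i _; rewrite ler_wiXn2l ?(ltW w1) ?(ltnW (ltn_ord i)).
  rewrite -[leRHS]mul1r ler_pdivlMr ?subr_gt0 // mulrC -opprB mulNr -subrX1.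
  by rewrite opprB gerBl exprn_ge0.
apply: norm_cvg0; apply: (@squeeze_cvgr _ _ _ _ (fun=> 0) (geometric (1 - w)^-1 w)).
- near=> N; rewrite normr_ge0 /= normrM normr_nat normrX -ww -exprM mul2n -addnn.
  by rewrite exprD mulrA ler_wpM2r ?exprn_ge0.
- exact: cvg_cst.
- by apply: cvg_geometric; rewrite ger0_norm.
Unshelve. all: by end_near. Qed.

(** Makes the boundary term of the partial-sum identity vanish in the limit. Writing x = w v inside
    the unit ball, v^N absorbs the last linear factor and the induction hypothesis applies at w
    instead of x. *)
Lemma deg_ffact_expr_cvg0 (R : realType) (lam : R) n (x : R) : `|x| < 1 ->
  (fun N => deg_ffact lam N%:R n * x ^+ N) @ \oo --> (0 : R).
Proof.
elim: n x => [|n IHn] x x1.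
  under eq_fun do rewrite deg_ffact0.
  exact: (cvg_geometric 1 x1).
pose w := Num.sqrt `|x|; pose v := Num.sg x * w.
have nw : `|w| < 1 by rewrite ger0_norm ?sqrtr_ge0 // -sqrtr1 ltr_sqrt.
have nv : `|v| < 1.
  apply: le_lt_trans nw; rewrite normrM normr_sg.
  by case: (x != 0); rewrite ?mul1r ?mul0r.
have -> : x = w * v.
  by rewrite mulrCA -expr2 sqr_sqrtr // -numEsg.
rewrite [X in X @ _ --> _](_ : _ = (fun N => deg_ffact lam N%:R n * w ^+ N) \*
    (fun N => N%:R * v ^+ N - n%:R * lam * v ^+ N)); last first.
  by apply/funext => N /=; rewrite deg_ffactS exprMn; ring.
rewrite -[X in _ --> X](mulr0 (0 : R)); apply: cvgM; first exact: IHn.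
rewrite -[X in _ --> X](subr0 (0 : R)); apply: cvgB; first exact: natr_expr_cvg0.
exact: cvg_geometric.
Qed.

(* Comes from [j = (j + 1) + (-1)]: the degenerate Vandermonde
   convolution expands (j)_{n,lam} in the (j+1)_{i,lam}, and (-1)_{k,lam} is
   (-1)^k (1)_{k,-lam}. Summing over j < N, the left-hand side picks up the
   boundary term at N. *)
Lemma deg_ffact_partial_sum (R : realType) (lam x : R) n N : (0 < n)%N ->
  (x - 1) * series (fun j => deg_ffact lam j.+1%:R n * x ^+ j) N =
  deg_ffact lam N%:R n * x ^+ N +
  \sum_(i < n) 'C(n, i)%:R * ((- 1) ^+ (n - i) * deg_ffact (- lam) 1 (n - i)) *
    series (fun j => deg_ffact lam j.+1%:R i * x ^+ j) N.
Proof.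
move=> n0; elim: N => [|N IHN].
  (* At N = 0 the boundary term is (0)_{n,lam}, which vanishes only because n > 0. *)
  rewrite /series /= big_geq // mulr0; case: n n0 => // n _.
  rewrite deg_ffact_0l mul0r add0r big1 // => i _.
  by rewrite big_geq // mulr0.
under eq_bigr do rewrite seriesSr mulrDr.
rewrite seriesSr big_split /= mulrDr IHN.
have := deg_ffactD lam N.+1%:R (- 1) n.
rewrite -[in X in X -> _]natr1 addrK natr1 big_ord_recr /= binn subnn deg_ffact0.
under eq_bigr do rewrite deg_ffactN.
move=> ->; rewrite [X in _ = _ + (_ + X)](_ : _ = (\sum_(i < n) 'C(n, i)%:R *
  deg_ffact lam N.+1%:R i * ((- 1) ^+ (n - i) * deg_ffact (- lam) 1 (n - i))) *
  x ^+ N); last by rewrite mulr_suml; apply: eq_bigr => i _; ring.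
by rewrite exprS; ring.
Qed.

(** Stated for any family [p], so that it yields both the existence of the next polynomial and the
    recurrence. The partial-sum identity is divided by x - 1 and passed to the limit. *)
Lemma is_deg_eulerian_rec (R : realType) (lam : R) n (p : nat -> {poly R}) :
  (0 < n)%N -> (forall i, (i < n)%N -> is_deg_eulerian lam i (p i)) ->
  is_deg_eulerian lam n
    (\sum_(i < n) 'C(n, i)%:R * p i * (deg_ffact (- lam) 1 (n - i))%:P
                  * ('X - 1) ^+ (n - i - 1)).
Proof.
move=> n0 pP x x1.
have yN0 : 1 - x != 0.
  by rewrite gt_eqF // subr_gt0 (le_lt_trans (ler_norm x)).
have xN0 : x - 1 != 0 by rewrite -opprB oppr_eq0.
rewrite [X in X @ _ --> _](_ : _ = fun N => (x - 1)^-1 *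
  (deg_ffact lam N%:R n * x ^+ N +
  \sum_(i < n) 'C(n, i)%:R * ((- 1) ^+ (n - i) * deg_ffact (- lam) 1 (n - i)) *
    series (fun j => deg_ffact lam j.+1%:R i * x ^+ j) N)); last first.
  by apply/funext => N; rewrite -deg_ffact_partial_sum // mulKf.
rewrite [X in _ --> X](_ : _ = (x - 1)^-1 * (0 +
  \sum_(i < n) 'C(n, i)%:R * ((- 1) ^+ (n - i) * deg_ffact (- lam) 1 (n - i)) *
    ((p i).[x] / (1 - x) ^+ i.+1))); last first.
  rewrite add0r horner_sum mulr_suml mulr_sumr; apply: eq_bigr => -[i /= ltin] _.
  rewrite !hornerE hornerMn hornerC.
  have -> : (1 - x) ^+ n.+1 = (1 - x) ^+ i.+1 * (1 - x) ^+ (n - i).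
    by rewrite -exprD addSn subnKC // ltnW.
  rewrite -subnSK // subn1 /=; move: (n - i.+1)%N => k.
  (* With y = 1 - x and k = n - i - 1, the signs match because (-1)^(k+1) / (-y) = (-1)^k / y. *)
  rewrite -[x - 1]opprB; move: (1 - x) yN0 => y y0.
  rewrite [(- y) ^+ k]exprNn !exprS /=.
  by field; rewrite y0 !expf_neq0.
apply: cvgMl_tmp; apply: cvgD; first exact: deg_ffact_expr_cvg0.
apply: cvg_big; first exact: add_continuous.
by move=> i _; apply: cvgMl_tmp; apply: pP.
Qed.

Lemma poly_eq_on_unit_ball (R : realType) (p q : {poly R}) :
  (forall x, `|x| < 1 -> p.[x] = q.[x]) -> p = q.
Proof.
move=> pq; apply/eqP; rewrite -subr_eq0; apply/eqP.
(* The points 1/(k+2) are distinct and inside the ball; [size (p - q)] of them exceed the degree. *)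
pose rs := [seq (k.+2%:R : R)^-1 | k <- iota 0 (size (p - q))].
apply: (@roots_geq_poly_eq0 _ _ rs).
- apply/allP => _ /mapP[k _ ->]; rewrite rootE hornerD hornerN pq ?subrr //.
  by rewrite ger0_norm ?invr_ge0 ?ler0n // invf_lt1 ?ltr0n // ltr1n.
- rewrite map_inj_uniq ?iota_uniq // => i j /invr_inj /eqP.
  by rewrite eqr_nat => /eqP[].
- by rewrite size_map size_iota.
Qed.

Lemma is_deg_eulerian_uniq (R : realType) (lam : R) n (p q : {poly R}) :
  is_deg_eulerian lam n p -> is_deg_eulerian lam n q -> p = q.
Proof.
move=> pP qP; apply: poly_eq_on_unit_ball => x x1.
have yN0 : (1 - x) ^+ n.+1 != 0.
  by rewrite expf_neq0 // gt_eqF // subr_gt0 (le_lt_trans (ler_norm x)).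
apply: (mulIf (invr_neq0 yN0)).
exact: (cvg_unique (@Rhausdorff R) (pP x x1) (qP x x1)).
Qed.

Lemma deg_eulerianE (R : realType) (lam : R) n (p : {poly R}) :
  is_deg_eulerian lam n p -> deg_eulerian lam n = p.
Proof.
move=> pP; apply: xget_unique => // q qP.
exact: is_deg_eulerian_uniq qP pP.
Qed.

Lemma is_deg_eulerian0 (R : realType) (lam : R) : is_deg_eulerian lam 0 1.
Proof.
move=> x x1; rewrite hornerC expr1.
rewrite [X in series X](_ : _ = geometric 1 x); first exact: cvg_geometric_series.
by apply/funext => j; rewrite deg_ffact0.
Qed.

(** Existence: the recurrence builds a witness by strong induction, so [xget] never falls back to
    its default 0. *)
Lemma deg_eulerianP (R : realType) (lam : R) n :
  is_deg_eulerian lam n (deg_eulerian lam n).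
Proof.
elim/ltn_ind: n => -[_|n IHn].
  by rewrite (deg_eulerianE (is_deg_eulerian0 lam)); exact: is_deg_eulerian0.
have nP := is_deg_eulerian_rec (ltn0Sn n) IHn.
by rewrite (deg_eulerianE nP).
Qed.

Theorem theorem2p3 (R : realType) (lam : R) (hlam : lam != 0) :
  deg_eulerian lam 0 = 1 /\
  forall n : nat, (1 <= n)%N ->
    deg_eulerian lam n =
      \sum_(i < n) 'C(n, i)%:R * deg_eulerian lam i
                   * (deg_ffact (- lam) 1 (n - i))%:P
                   * ('X - 1) ^+ (n - i - 1).
Proof.
split=> [|n n0]; first exact/deg_eulerianE/is_deg_eulerian0.
by apply: deg_eulerianE; apply: is_deg_eulerian_rec => // i _; exact: deg_eulerianP.
Qed.
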